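(* Let $T>0$, $0<\alpha<1$, let $M(\alpha)$ be a nonzero real number, and let $f\in AC[0,T]$. Define the Caputo--Fabrizio (CF) integral of $f$ by $${}^{CF}\!J_0^{\alpha} f(t) = \frac{1-\alpha}{M(\alpha)} f(t) + \frac{\alpha}{M(\alpha)}\int_0^t f(\tau)\,d\tau,$$ and, for $h\in AC[0,T]$, the Caputo--Fabrizio (CF) derivative of $h$ by $${}^{CF}\!D_0^{\alpha} h(t) = \frac{M(\alpha)}{1-\alpha}\int_0^t \exp\Bigl(-\frac{\alpha}{1-\alpha}(t-\tau)\Bigr) h'(\tau)\,d\tau.$$ Then, for $0<t\le T$, $${}^{CF}\!D_0^{\alpha}\bigl[{}^{CF}\!J_0^{\alpha} f\bigr](t) = f(t) - \exp\Bigl(-\frac{\alpha}{1-\alpha}t\Bigr) f(0).$$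
   Context: $AC[0,T]$ is the space of absolutely continuous functions on $[0,T]$: $f\in AC[0,T]$ if and only if $f(t)=f(0)+\int_0^t f'(s)\,ds$ for $0\le t\le T$ with some $f'\in L^1[0,T]$. $M(\alpha)$ is a normalization factor, regarded as a function of $\alpha$ with $M(0)=M(1)=1$. *)

(* Defs.v *)
From HB Require Import structures.
From mathcomp Require Import all_boot all_order all_algebra.
From mathcomp Require Import all_classical all_reals all_analysis.

Set Implicit Arguments.
Unset Strict Implicit.
Unset Printing Implicit Defensive.

Import Order.TTheory GRing.Theory Num.Theory.
Import numFieldNormedType.Exports.

Local Open Scope classical_set_scope.
Local Open Scope ring_scope.

(* [g] is a version of f' : an L^1 function on [0, T] with
   f(t) = f(0) + int_0^t g. It is determined by f up to a Lebesgue-null set.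
   The values of f and g outside [0, T] are irrelevant. *)
Definition is_ac_derivative (R : realType) (T : R) (f g : R -> R) : Prop :=
  (@lebesgue_measure R).-integrable `[0, T] (EFin \o g) /\
  forall t : R, 0 <= t <= T ->
    f t = f 0 + \int[@lebesgue_measure R]_(s in `[0, t]) g s.

Definition abs_continuous_on (R : realType) (T : R) (f : R -> R) : Prop :=
  exists g : R -> R, is_ac_derivative T f g.

(* A chosen version of f' (and the zero function if f is not absolutely continuous). *)
Definition ac_derivative (R : realType) (T : R) (f : R -> R) : R -> R :=
  xget (fun=> 0) [set g | is_ac_derivative T f g].

Definition CF_integral (R : realType) (M : R -> R) (alpha : R) (f : R -> R)
    (t : R) : R :=
  (1 - alpha) / M alpha * f t +
  alpha / M alpha * \int[@lebesgue_measure R]_(tau in `[0, t]) f tau.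

(* Meant for absolutely continuous h and 0 <= t <= T; the value then does not depend on
   the version of h' that is integrated. *)
Definition CF_derivative (R : realType) (T : R) (M : R -> R) (alpha : R)
    (h : R -> R) (t : R) : R :=
  M alpha / (1 - alpha) *
  \int[@lebesgue_measure R]_(tau in `[0, t])
    (expR (- (alpha / (1 - alpha)) * (t - tau)) * ac_derivative T h tau).

(* Main.v *)
Require Import Defs.
From HB Require Import structures.
From mathcomp Require Import all_boot all_order all_algebra.
From mathcomp Require Import all_classical all_reals all_analysis.
From mathcomp Require Import measurable_realfun ring lra.

Set Implicit Arguments.
Unset Strict Implicit.
Unset Printing Implicit Defensive.

Import Order.TTheory GRing.Theory Num.Theory.
Import numFieldNormedType.Exports.

Local Open Scope classical_set_scope.
Local Open Scope ring_scope.

(* Integration by parts for absolutely continuous functions (Fubini on the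
   triangle 0 <= x <= y <= T) expresses the CF derivative of h through the values
   of h alone, so the choice of the version of h' plays no role. With
   b = alpha / (1 - alpha), h = CF_integral f and F(t) = int_0^t f, a second
   integration by parts, applied to exp(b x) and F, evaluates
   int_0^t h(x) b exp(b x) dx = alpha / M(alpha) exp(b t) F(t), and F cancels. *)

(** * Fubini on a triangle *)

Section double_integrals.
Context {R : realType}.
Let mu : {measure set (measurableTypeR R) -> \bar R} := @lebesgue_measure R.

(** By Tonelli, the iterated integral of |e(x)| |g(y)| factors into the product of two finite
    integrals. *)
Lemma integrable_prod (e g : R -> R) :
  mu.-integrable setT (EFin \o e) -> mu.-integrable setT (EFin \o g) ->
  (@lebesgue_measure R \x @lebesgue_measure R)%E.-integrable setT
    (fun p : measurableTypeR R * measurableTypeR R => (e p.1 * g p.2)%:E).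
Proof.
move=> ie ig.
have me := measurable_int _ ie; have mg := measurable_int _ ig.
apply/integrable12ltyP.
  apply/measurable_EFinP/measurable_funM.
    by apply: measurableT_comp (measurable_fst) => //; exact/measurable_EFinP.
  by apply: measurableT_comp (measurable_snd) => //; exact/measurable_EFinP.
move/integrable_abse : ie => ie; move/integrable_abse : ig => ig.
have ig' : (\int[mu]_y `|(g y)%:E| \is a fin_num)%E.
  exact: integrable_fin_num.
under eq_integral => x _.
  under eq_integral do rewrite EFinM abseM /=.
  rewrite ge0_integralZl//; last exact: measurable_int ig.
  over.
rewrite ge0_integralZr//; last 2 first.
  exact: measurable_int ie.
  exact: integral_ge0.
by rewrite ltey_eq fin_numM// integrable_fin_num.
Qed.

(** Both sides are iterated integrals of e(x) g(y) over the triangle a <= x <= y <= b, taken in the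
    two possible orders. *)
Lemma Rintegral_triangle (a b : R) (e g : R -> R) :
  mu.-integrable `[a, b] (EFin \o e) -> mu.-integrable `[a, b] (EFin \o g) ->
  \int[mu]_(x in `[a, b]) (e x * \int[mu]_(y in `[x, b]) g y) =
  \int[mu]_(y in `[a, b]) (g y * \int[mu]_(x in `[a, y]) e x).
Proof.
move=> ie ig.
have memI (c d z : R) : (z \in `[c, d]%classic) = (c <= z <= d).
  by rewrite mem_setE in_itv.
pose D : set R := `[a, b]%classic; pose A := [set p : R * R | p.1 <= p.2].
have memA (x y : R) : ((x, y) \in A) = (x <= y) by exact: asboolb.
(* Extension by zero outside [D] and the indicator of the half-plane [A] turn the integral over the
   triangle into one over the whole plane; the product of the extended functions dominates [F]. *)
pose F p : \bar R := ((e \_ D) p.1 * (g \_ D) p.2 * \1_A p)%:E.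
have mA : measurable (A : set (measurableTypeR R * measurableTypeR R)).
  rewrite -[A]setTI.
  exact: (@measurable_fun_le _ (measurableTypeR R * measurableTypeR R)%type).
have iprod : (@lebesgue_measure R \x @lebesgue_measure R)%E.-integrable setT
    (fun p : measurableTypeR R * measurableTypeR R =>
      ((e \_ D) p.1 * (g \_ D) p.2)%:E).
  apply: integrable_prod; rewrite -restrict_EFin.
    by apply: (iffLR (integrable_mkcond _ _)) ie; exact: measurable_itv.
  by apply: (iffLR (integrable_mkcond _ _)) ig; exact: measurable_itv.
have iF : (@lebesgue_measure R \x @lebesgue_measure R)%E.-integrable setT F.
  apply: (le_integrable measurableT _ _ iprod).
    apply/measurable_EFinP/measurable_funM; last exact/measurable_indicP.
    by have /measurable_EFinP := measurable_int _ iprod.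
  move=> p _; rewrite lee_fin normrM ler_piMr// indicE.
  by case: (p \in A); rewrite ?normr1 ?normr0.
have Fub := Fubini iF.
have Fub1 : (\int[mu]_x \int[mu]_y F (x, y) =
    \int[mu]_(x in D) (e x * \int[mu]_(y in `[x, b]) g y)%:E)%E.
  rewrite [RHS]integral_mkcond; apply: eq_integral => x _.
  rewrite [RHS]patchE; case: ifPn => xD; last first.
    by apply: integral0_eq => y _; rewrite /F/= patchE (negbTE xD) !mul0r.
  have /andP[ax xb] : a <= x <= b by move: xD; rewrite memI.
  have ixg : mu.-integrable `[x, b] (EFin \o g).
    apply: integrableS ig; [exact: measurable_itv|exact: measurable_itv|].
    by apply: subset_itvr; rewrite bnd_simp.
  rewrite EFinM fineK; last first.
    by apply: integrable_fin_num ixg; exact: measurable_itv.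
  rewrite -integralZl; [|exact: measurable_itv|exact: ixg].
  rewrite [RHS]integral_mkcond.
  apply: eq_integral => y _.
  rewrite /F/= !patchE xD indicE memA /D !memI.
  (* Once a <= x <= y, membership of y in [a, b] and in [x, b] both amount to y <= b. *)
  case: (leP x y) => xy /=; last by rewrite mulr0.
  by rewrite (le_trans ax xy) mulr1/=; case: ifP => _; rewrite ?mulr0.
have Fub2 : (\int[mu]_y \int[mu]_x F (x, y) =
    \int[mu]_(y in D) (g y * \int[mu]_(x in `[a, y]) e x)%:E)%E.
  rewrite [RHS]integral_mkcond; apply: eq_integral => y _.
  rewrite [RHS]patchE; case: ifPn => yD; last first.
    by apply: integral0_eq => x _; rewrite /F/= [(g \_ D) y]patchE (negbTE yD);
      rewrite mulr0 mul0r.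
  have /andP[ay yb] : a <= y <= b by move: yD; rewrite memI.
  have iye : mu.-integrable `[a, y] (EFin \o e).
    apply: integrableS ie; [exact: measurable_itv|exact: measurable_itv|].
    by apply: subset_itvl; rewrite bnd_simp.
  rewrite EFinM fineK; last first.
    by apply: integrable_fin_num iye; exact: measurable_itv.
  rewrite -integralZl; [|exact: measurable_itv|exact: iye].
  rewrite [RHS]integral_mkcond.
  apply: eq_integral => x _.
  rewrite /F/= !patchE yD indicE memA /D !memI.
  case: (leP x y) => xy /=; last by rewrite andbF mulr0.
  rewrite (le_trans xy yb) mulr1 andbT; case: ifP => _; last by rewrite mul0r.
  by rewrite mulrC EFinM.
by congr fine; exact: etrans (esym Fub1) (etrans Fub Fub2).
Qed.
End double_integrals.

(** * Calculus of absolutely continuous functions *)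

Section absolute_continuity.
Context {R : realType}.
Let mu : {measure set (measurableTypeR R) -> \bar R} := @lebesgue_measure R.
Implicit Types (T : R) (f g h k : R -> R).

Lemma is_ac_derivative_le T t h g : t <= T ->
  is_ac_derivative T h g -> is_ac_derivative t h g.
Proof.
move=> tT [ig hE]; split.
  apply: integrableS ig; [exact: measurable_itv|exact: measurable_itv|].
  by apply: subset_itvl; rewrite bnd_simp.
by move=> s /andP[s0 st]; apply: hE; rewrite s0 (le_trans st tT).
Qed.

Lemma is_ac_derivative_continuous T h g : 0 <= T ->
  is_ac_derivative T h g -> {within `[0, T], continuous h}.
Proof.
move=> T0 [ig hE].
have c : {within `[0, T], continuous
    (cst (h 0) + (fun x => parameterized_integral mu 0 x g))}.
  apply: within_continuousD; last exact: parameterized_integral_continuous.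
  by apply: continuous_subspaceT => x; exact: cst_continuous.
apply: subspace_eq_continuous c => x /=.
by rewrite mem_setE in_itv => /hE hx; rewrite [RHS]hx.
Qed.

(** A continuous function on a compact interval is measurable and bounded, so multiplying by it
    preserves integrability. *)
Lemma continuous_integrableM T h k :
  {within `[0, T], continuous h} -> mu.-integrable `[0, T] (EFin \o k) ->
  mu.-integrable `[0, T] (EFin \o (fun x => h x * k x)).
Proof.
move=> ch ik.
have -> : EFin \o (fun x => h x * k x) = ((EFin \o h) \* (EFin \o k))%E by [].
apply: integrableMr => //.
  exact: subspace_continuous_measurable_fun.
have /compact_bounded[M [_ mrt]] := continuous_compact ch (@segment_compact _ _ _).
by exists M; split; rewrite ?num_real // => ? ? ? ?; exact: mrt.
Qed.

(** The triangle exchange is applied to f'(x) g'(y): its inner integrals are g(T) - g(x) and f(y) -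
    f(0), and expanding both sides leaves the boundary terms. *)
Lemma Rintegration_by_parts_ac T f f' g g' : 0 <= T ->
  is_ac_derivative T f f' -> is_ac_derivative T g g' ->
  \int[mu]_(x in `[0, T]) (f x * g' x) =
  f T * g T - f 0 * g 0 - \int[mu]_(x in `[0, T]) (g x * f' x).
Proof.
move=> T0 acf acg.
have cf := is_ac_derivative_continuous T0 acf.
have cg := is_ac_derivative_continuous T0 acg.
have [[if' fE] [ig' gE]] := (acf, acg).
have TT : 0 <= T <= T by rewrite T0 lexx.
have cc (a : R) : {within `[0, T], continuous (fun=> a : R)}.
  by move=> x; exact: cst_continuous.
have gtail x : x \in `[0, T] -> \int[mu]_(y in `[x, T]) g' y = g T - g x.
  rewrite in_itv/= => xT; have /andP[x0 x1] := xT.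
  rewrite [g T]gE// [g x]gE// opprD addrACA subrr add0r.
  (* The difference is an integral over the half-open interval from x to T; its missing endpoint x
     is a null set. *)
  rewrite Rintegral_itvB; [|exact: ig'|by rewrite bnd_simp..].
  rewrite Rintegral_itv_obnd_cbnd//.
  apply: integrableS ig'; [exact: measurable_itv|exact: measurable_itv|].
  by apply: subset_itv; rewrite bnd_simp.
have := Rintegral_triangle if' ig'.
have -> : \int[mu]_(x in `[0, T]) (f' x * \int[mu]_(y in `[x, T]) g' y) =
    g T * (f T - f 0) - \int[mu]_(x in `[0, T]) (g x * f' x).
  transitivity (\int[mu]_(x in `[0, T]) (g T * f' x - g x * f' x)).
    apply: eq_Rintegral => x; rewrite mem_setE => /gtail ->.
    by rewrite mulrBr ![_ * f' x]mulrC.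
  rewrite RintegralB; [|exact: measurable_itv|exact: continuous_integrableM|
    exact: continuous_integrableM].
  rewrite RintegralZl; [|exact: measurable_itv|exact: if'].
  by have -> := fE _ TT; rewrite [f 0 + _]addrC addrK.
have -> : \int[mu]_(y in `[0, T]) (g' y * \int[mu]_(x in `[0, y]) f' x) =
    \int[mu]_(x in `[0, T]) (f x * g' x) - f 0 * (g T - g 0).
  transitivity (\int[mu]_(x in `[0, T]) (f x * g' x - f 0 * g' x)).
    apply: eq_Rintegral => x; rewrite mem_setE in_itv => /fE ->.
    by rewrite -mulrBl addrAC subrr add0r mulrC.
  rewrite RintegralB; [|exact: measurable_itv|exact: continuous_integrableM|
    exact: continuous_integrableM].
  rewrite RintegralZl; [|exact: measurable_itv|exact: ig'].
  by have -> := gE _ TT; rewrite [g 0 + _]addrC addrK.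
lra.
Qed.

Lemma is_ac_derivative_expR T c :
  is_ac_derivative T (fun x => expR (c * x)) (fun x => c * expR (c * x)).
Proof.
have dE (x : R) : is_derive x (1 : R) (fun x => expR (c * x)) (c * expR (c * x)).
  have -> : c * expR (c * x) = expR (c * x) *: (c *: (1 : R)).
    by rewrite /GRing.scale/= mulr1 mulrC.
  exact: is_derive1_comp.
have cE : continuous (fun x : R => c * expR (c * x)).
  move=> x; apply: cvgM; first exact: cvg_cst.
  by apply: continuous_comp; [exact: mulrl_continuous|exact: continuous_expR].
split.
  apply: continuous_compact_integrable; first exact: segment_compact.
  exact: continuous_subspaceT.
(* The fundamental theorem of calculus is invoked for 0 < t; at t = 0 the integral is over a single
   point. *)
move=> t /andP[]; rewrite le_eqVlt => /predU1P[<- _|t0 _].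
  by rewrite set_itv1 Rintegral_set1 addr0.
have FTC := @continuous_FTC2 R (fun x => c * expR (c * x))
  (fun x => expR (c * x)) 0 t t0.
have cexp : continuous (fun x : R => expR (c * x)).
  by move=> x; apply: continuous_comp; [exact: mulrl_continuous|exact: continuous_expR].
rewrite /Rintegral FTC.
- by rewrite -EFinB /= [RHS]addrC subrK.
- exact: continuous_subspaceT.
- split=> [x _||]; first exact: ex_derive.
  + exact: cvg_at_right_filter (cexp 0).
  + exact: cvg_at_left_filter (cexp t).
- by move=> x _; rewrite derive1E; apply: derive_val.
Qed.

(** With g the primitive of f, the combination has the shape of [CF_integral]. *)
Lemma is_ac_derivative_lin T (a b : R) f f' g g' :
  is_ac_derivative T f f' -> is_ac_derivative T g g' ->
  is_ac_derivative T (fun x => a * f x + b * g x) (fun x => a * f' x + b * g' x).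
Proof.
move=> [if' fE] [ig' gE].
have i h c : mu.-integrable `[0, T] (EFin \o h) ->
    mu.-integrable `[0, T] (EFin \o (fun x => c * h x)).
  by apply: integrableZl; exact: measurable_itv.
split.
  have -> : EFin \o (fun x => a * f' x + b * g' x) =
    ((EFin \o (fun x => a * f' x)%R) \+ (EFin \o (fun x => b * g' x)%R))%E by [].
  by apply: integrableD; [exact: measurable_itv|exact: i|exact: i].
move=> t /andP[t0 tT]; rewrite [f t]fE ?t0// [g t]gE ?t0//.
have sub h : mu.-integrable `[0, T] (EFin \o h) -> mu.-integrable `[0, t] (EFin \o h).
  move=> ih; apply: integrableS ih; [exact: measurable_itv|exact: measurable_itv|].
  by apply: subset_itvl; rewrite bnd_simp.
rewrite RintegralD; [|exact: measurable_itv|exact/sub/i|exact/sub/i].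
rewrite !RintegralZl; try by [exact: measurable_itv|exact: sub].
by rewrite !mulrDr addrACA.
Qed.

Lemma is_ac_derivative_Rintegral T f : mu.-integrable `[0, T] (EFin \o f) ->
  is_ac_derivative T (fun t => \int[mu]_(s in `[0, t]) f s) f.
Proof.
by move=> i; split=> // t _; rewrite set_itv1 Rintegral_set1 add0r.
Qed.

Lemma ac_derivativeP T f : abs_continuous_on T f ->
  is_ac_derivative T f (ac_derivative T f).
Proof. exact: xgetPex. Qed.

End absolute_continuity.

Theorem proposition3p1 (R : realType) (T : R) (M : R -> R) (alpha : R)
    (f : R -> R) (hT : 0 < T) (halpha : 0 < alpha < 1)
    (hM0 : M 0 = 1) (hM1 : M 1 = 1) (hM : M alpha <> 0) (hf : abs_continuous_on T f) :
  abs_continuous_on T (CF_integral M alpha f) /\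
  forall t : R, 0 < t <= T ->
    CF_derivative T M alpha (CF_integral M alpha f) t =
    f t - expR (- (alpha / (1 - alpha)) * t) * f 0.
Proof.
have [f' acf] := hf.
have if_ : (@lebesgue_measure R).-integrable `[0, T] (EFin \o f).
  apply: continuous_compact_integrable; first exact: segment_compact.
  exact: is_ac_derivative_continuous (ltW hT) acf.
pose F (x : R) := \int[@lebesgue_measure R]_(s in `[0, x]) f s.
have acF : is_ac_derivative T F f := is_ac_derivative_Rintegral if_.
set h := CF_integral M alpha f.
(* Absolute continuity of [h] ensures that [ac_derivative T h] is a genuine version of h' and not
   the default zero function. Unification supplies the witness (1 - alpha) / M(alpha) f' + alpha /
   M(alpha) f. *)
have ach : abs_continuous_on T h.
  by eexists; exact: is_ac_derivative_lin acf acF.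
split=> // t /andP[t0 tT].
set b := alpha / (1 - alpha).
have aneq : 1 - alpha != 0 by rewrite subr_eq0 eq_sym; case/andP: halpha => _ /lt_eqF ->.
have Mneq : M alpha != 0 by apply/eqP.
have F0 : F 0 = 0 by rewrite /F set_itv1 Rintegral_set1.
have t0' := ltW t0.
have acE : is_ac_derivative t _ _ := is_ac_derivative_expR t b.
have cE := is_ac_derivative_continuous t0' acE.
(* The version of h' is chosen on [0, T]; its restriction to [0, t] lets integration by parts end at
   t. *)
have ach' := is_ac_derivative_le tT (ac_derivativeP ach).
have acFt := is_ac_derivative_le tT acF.
have cF := is_ac_derivative_continuous t0' acFt.
have parts_h := Rintegration_by_parts_ac t0' acE ach'.
have parts_F := Rintegration_by_parts_ac t0' acE acFt.
have [ih' _] := ach'; have [ift _] := acFt; have [iE' _] := acE.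
have mI : measurable (`[0, t]%classic : set (measurableTypeR R)).
  exact: measurable_itv.
(* The kernel splits as exp(-b (t - x)) = exp(-b t) exp(b x), and the first factor leaves the
   integral. *)
have -> : CF_derivative T M alpha h t = M alpha / (1 - alpha) *
    (expR (- b * t) * \int[@lebesgue_measure R]_(x in `[0, t])
      (expR (b * x) * ac_derivative T h x)).
  congr (_ * _); rewrite -RintegralZl; [|exact: mI|exact: continuous_integrableM].
  apply: eq_Rintegral => x _.
  by rewrite mulrA -expRD mulrBr [- b * x]mulNr opprK.
(* Since b (1 - alpha) = alpha, the integrand is alpha / M(alpha) times the derivative of exp(b x)
   F(x) given by the product rule. *)
have hint : \int[@lebesgue_measure R]_(x in `[0, t]) (h x * (b * expR (b * x))) =
    alpha / M alpha * (\int[@lebesgue_measure R]_(x in `[0, t]) (expR (b * x) * f x) +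
      \int[@lebesgue_measure R]_(x in `[0, t]) (F x * (b * expR (b * x)))).
  have i1 := continuous_integrableM cE ift.
  have i2 := continuous_integrableM cF iE'.
  rewrite -RintegralD; [|exact: mI|exact: i1|exact: i2].
  rewrite -RintegralZl; [|exact: mI|exact: integrableD i1 i2].
  apply: eq_Rintegral => x _; rewrite /h /CF_integral -/(F x) /b.
  by field; rewrite aneq.
(* After F(t) cancels, the integral of exp(b x) h'(x) is (1 - alpha) / M(alpha) (exp(b t) f(t) -
   f(0)); the prefactor M(alpha) / (1 - alpha) exp(-b t) turns it into the claim. *)
rewrite parts_h hint parts_F F0 /h /CF_integral -/(F t) -/(F 0) F0 !mulr0 expR0.
rewrite mulNr expRN; field.
by rewrite expR_eq0 Mneq aneq.
Qed.
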